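(* The rule $\mathsf{cut}$: from $\Gamma\Rightarrow A$ and $\Sigma,A\Rightarrow C$ infer $\Gamma,\Sigma\Rightarrow C$, is admissible in the sequent calculus $\mathsf{G1MK}$; that is, whenever both premisses are derivable in $\mathsf{G1MK}$, so is the conclusion.
   Context: Formulas are from the language $A ::= p \mid \bot \mid A\wedge A \mid A\vee A \mid A\to A \mid \Box A \mid \Diamond A$. A sequent is $\Gamma\Rightarrow\Delta$ with $\Gamma,\Delta$ finite multisets of formulas; for a multiset $\Sigma=A_1,\dots,A_n$, $\Box\Sigma=\Box A_1,\dots,\Box A_n$. A derivation is a finite tree of sequents whose leaves are initial sequents and each inner node follows from its children by a rule. $\mathsf{G1MK}$ has single-succedent sequents ($\Gamma$ a multiset, $C$ a single formula) with: initial sequents $A\Rightarrow A$; (L$\wedge$) $\Gamma,A_i\Rightarrow C$ / $\Gamma,A_1\wedge A_2\Rightarrow C$ ($i=1,2$); (R$\wedge$) $\Gamma\Rightarrow A$ and $\Gamma\Rightarrow B$ / $\Gamma\Rightarrow A\wedge B$; (L$\vee$) $\Gamma,A\Rightarrow C$ and $\Gamma,B\Rightarrow C$ / $\Gamma,A\vee B\Rightarrow C$; (R$\vee$) $\Gamma\Rightarrow A_i$ / $\Gamma\Rightarrow A_1\vee A_2$; (R$\to$) $\Gamma,A\Rightarrow B$ / $\Gamma\Rightarrow A\to B$; (L$\to$) $\Gamma\Rightarrow A$ and $\Gamma,B\Rightarrow C$ / $\Gamma,A\to B\Rightarrow C$; (LW) $\Gamma\Rightarrow C$ / $\Gamma,A\Rightarrow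 C$; (LC) $\Gamma,A,A\Rightarrow C$ / $\Gamma,A\Rightarrow C$; (K$\Box$) $\Sigma\Rightarrow A$ / $\Box\Sigma\Rightarrow\Box A$; (K$\Diamond$) $\Sigma,A\Rightarrow B$ / $\Box\Sigma,\Diamond A\Rightarrow\Diamond B$. *)

(* Defs.v *)
From HB Require Import structures.
From mathcomp Require Import all_boot.
From mathcomp Require Import finmap multiset.

Set Implicit Arguments.
Unset Strict Implicit.
Unset Printing Implicit Defensive.

Local Open Scope mset_scope.

(* Propositional variables are indexed by nat. *)
Inductive form : Type :=
| Var of nat
| Bot
| And of form & form
| Or of form & form
| Imp of form & form
| Box of form
| Dia of form.

(* Encoding into generic trees, used only to equip form with the choiceType
   structure that {mset form} requires. *)
Fixpoint form_tree (A : form) : GenTree.tree nat :=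
  match A with
  | Var p => GenTree.Leaf p
  | Bot => GenTree.Node 0 [::]
  | And B C => GenTree.Node 1 [:: form_tree B; form_tree C]
  | Or B C => GenTree.Node 2 [:: form_tree B; form_tree C]
  | Imp B C => GenTree.Node 3 [:: form_tree B; form_tree C]
  | Box B => GenTree.Node 4 [:: form_tree B]
  | Dia B => GenTree.Node 5 [:: form_tree B]
  end.

Fixpoint tree_form (t : GenTree.tree nat) : option form :=
  match t with
  | GenTree.Leaf p => Some (Var p)
  | GenTree.Node 0 [::] => Some Bot
  | GenTree.Node 1 [:: t1; t2] =>
      obind (fun B => omap (And B) (tree_form t2)) (tree_form t1)
  | GenTree.Node 2 [:: t1; t2] =>
      obind (fun B => omap (Or B) (tree_form t2)) (tree_form t1)
  | GenTree.Node 3 [:: t1; t2] =>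
      obind (fun B => omap (Imp B) (tree_form t2)) (tree_form t1)
  | GenTree.Node 4 [:: t1] => omap Box (tree_form t1)
  | GenTree.Node 5 [:: t1] => omap Dia (tree_form t1)
  | _ => None
  end.

Lemma form_treeK : pcancel form_tree tree_form.
Proof.
by elim=> //= [B -> C ->|B -> C ->|B -> C ->|B ->|B ->].
Qed.

HB.instance Definition _ := Countable.copy form (pcan_type form_treeK).

Implicit Types (A B C : form) (G S : {mset form}).

(* [seq Box A | A <- S] enumerates S with multiplicities. *)
Definition box_mset (S : {mset form}) : {mset form} :=
  seq_mset [seq Box A | A <- S].

(* [G1MK G C] means that the sequent G => C has a derivation. Since contexts
   are multisets, no exchange rule is needed. The logic is minimal: no rule
   concerns Bot. *)
Inductive G1MK : {mset form} -> form -> Prop :=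
| G1MK_init A : G1MK [mset A] A
| G1MK_Land1 G (A1 A2 : form) C : G1MK (A1 +` G) C -> G1MK (And A1 A2 +` G) C
| G1MK_Land2 G (A1 A2 : form) C : G1MK (A2 +` G) C -> G1MK (And A1 A2 +` G) C
| G1MK_Rand G A B : G1MK G A -> G1MK G B -> G1MK G (And A B)
| G1MK_Lor G A B C :
    G1MK (A +` G) C -> G1MK (B +` G) C -> G1MK (Or A B +` G) C
| G1MK_Ror1 G (A1 A2 : form) : G1MK G A1 -> G1MK G (Or A1 A2)
| G1MK_Ror2 G (A1 A2 : form) : G1MK G A2 -> G1MK G (Or A1 A2)
| G1MK_Rimp G A B : G1MK (A +` G) B -> G1MK G (Imp A B)
| G1MK_Limp G A B C : G1MK G A -> G1MK (B +` G) C -> G1MK (Imp A B +` G) C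
| G1MK_LW G A C : G1MK G C -> G1MK (A +` G) C
| G1MK_LC G A C : G1MK (A +` (A +` G)) C -> G1MK (A +` G) C
| G1MK_KBox S A : G1MK S A -> G1MK (box_mset S) (Box A)
| G1MK_KDia S A B : G1MK (A +` S) B -> G1MK (Dia A +` box_mset S) (Dia B).

(* Main.v *)
Require Import Defs.
From mathcomp Require Import all_boot.
From mathcomp Require Import finmap multiset.

Local Open Scope mset_scope.

(** By weakening and contraction, derivability only depends on the underlying
    set of the antecedent, so a cut on [A] can be stated with an antecedent
    [G'] contained, as a set, in [A, G]; this absorbs contractions of [A].
    The proof is by induction on [A]. Left rules at the end of the derivation
    of [G => A] commute with the cut, so this derivation may be assumed to end
    with an axiom, a right rule or a modal rule; then one inducts on the
    derivation of [G' => C], a principal occurrence of [A] being replaced by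
    cuts on immediate subformulas of [A]. *)

Lemma sub_mset1D (T : choiceType) (a : T) (X Y : {mset T}) :
  {subset a +` X <= Y} -> a \in Y /\ {subset X <= Y}.
Proof.
move=> sXY; split; first by rewrite sXY // mset1D1.
by move=> x xX; rewrite sXY // mset1Dr.
Qed.

Lemma sub_mset1DS (T : choiceType) (a : T) (X Y : {mset T}) :
  {subset X <= Y} -> {subset a +` X <= a +` Y}.
Proof.
by move=> sXY x; rewrite !in_mset1D => /predU1P[->|/sXY->]; rewrite ?eqxx ?orbT.
Qed.

Lemma sub_mset1DSA (T : choiceType) (a b : T) (X Y : {mset T}) :
  {subset X <= a +` Y} -> {subset b +` X <= a +` (b +` Y)}.
Proof. by rewrite msetDCA; apply: sub_mset1DS. Qed.

Lemma sub_mset1Dr (T : choiceType) (a : T) (X : {mset T}) :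
  {subset X <= a +` X}.
Proof. by move=> x; apply: mset1Dr. Qed.

Lemma seq_mset_nil (T : choiceType) : seq_mset [::] = mset0 :> {mset T}.
Proof. by rewrite -enum_mset0 seq_mset_id. Qed.

Lemma mem_seq_mset (T : choiceType) (s : seq T) : seq_mset s =i s.
Proof. exact: perm_mem (perm_eq_seq_mset s). Qed.

Lemma sub_box_mset (S G : {mset form}) :
  {subset box_mset S <= G} <-> forall B, B \in S -> Box B \in G.
Proof.
split=> [sSG B BS|sSG B]; first by rewrite sSG // mem_seq_mset map_f.
by rewrite mem_seq_mset => /mapP[D DS ->]; apply: sSG.
Qed.

(** Weakening gives the sum of [G] and [G'] as antecedent; each formula of the extra copy of [G] is
    then contracted into an occurrence in [G']. *)
Lemma G1MK_sub (G G' : {mset form}) (C : form) :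
  G1MK G C -> {subset G <= G'} -> G1MK G' C.
Proof.
have weak (s : seq form) X : G1MK X C -> G1MK (seq_mset s `+` X) C.
  elim: s => [|A s IHs] dX; first by rewrite seq_mset_nil mset0D.
  by rewrite mset_cons -msetDA; apply/G1MK_LW/IHs.
have contr (s : seq form) X :
    {subset s <= X} -> G1MK (seq_mset s `+` X) C -> G1MK X C.
  elim: s => [|A s IHs] sX; first by rewrite seq_mset_nil mset0D.
  rewrite mset_cons -msetDA => d; apply: IHs => [x xs|].
    by apply: sX; rewrite inE xs orbT.
  move: d; rewrite -(msetB1K (sX A (mem_head _ _))) !(msetDCA _ [mset A]).
  exact: G1MK_LC.
move=> dG sGG'; apply: (contr G) => //.
by rewrite msetDC -[X in X `+` _]seq_mset_id; apply: weak; rewrite seq_mset_id.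
Qed.

Section CumulativeLeftRules.

Context {G : {mset form}}.
Implicit Types A B C : form.

Lemma G1MK_contr A C : A \in G -> G1MK (A +` G) C -> G1MK G C.
Proof. by move=> AG d; apply: G1MK_sub d _ => x; rewrite in_mset1D => /predU1P[->|]. Qed.

Lemma G1MK_Land1_in A B C : And A B \in G -> G1MK (A +` G) C -> G1MK G C.
Proof. by move=> ABG d; apply/(G1MK_contr _ _ ABG)/G1MK_Land1. Qed.

Lemma G1MK_Land2_in A B C : And A B \in G -> G1MK (B +` G) C -> G1MK G C.
Proof. by move=> ABG d; apply/(G1MK_contr _ _ ABG)/G1MK_Land2. Qed.

Lemma G1MK_Lor_in A B C :
  Or A B \in G -> G1MK (A +` G) C -> G1MK (B +` G) C -> G1MK G C.
Proof. by move=> ABG dA dB; apply/(G1MK_contr _ _ ABG)/G1MK_Lor. Qed.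

Lemma G1MK_Limp_in A B C :
  Imp A B \in G -> G1MK G A -> G1MK (B +` G) C -> G1MK G C.
Proof. by move=> ABG dA dB; apply/(G1MK_contr _ _ ABG)/G1MK_Limp. Qed.

End CumulativeLeftRules.

Lemma G1MK_mem (G : {mset form}) (A : form) : A \in G -> G1MK G A.
Proof. by move=> AG; apply: G1MK_sub (G1MK_init A) _ => x /mset1P->. Qed.

(* The final rules left once left rules are permuted away; the axiom and the
   modal rules are taken up to weakening of the antecedent. *)
Inductive right_intro (G : {mset form}) : form -> Prop :=
| RI_mem A : A \in G -> right_intro G A
| RI_and A B : G1MK G A -> G1MK G B -> right_intro G (And A B)
| RI_or1 A B : G1MK G A -> right_intro G (Or A B)
| RI_or2 A B : G1MK G B -> right_intro G (Or A B)
| RI_imp A B : G1MK (A +` G) B -> right_intro G (Imp A B)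
| RI_box S A :
    {subset box_mset S <= G} -> G1MK S A -> right_intro G (Box A)
| RI_dia S A B :
    Dia A \in G -> {subset box_mset S <= G} -> G1MK (A +` S) B ->
    right_intro G (Dia B).

Lemma right_intro_sub (G G' : {mset form}) (A : form) :
  right_intro G A -> {subset G <= G'} -> right_intro G' A.
Proof.
move=> rA sGG'; case: rA => {A}.
- by move=> A /sGG'; apply: RI_mem.
- by move=> A B dA dB; apply: RI_and; apply: G1MK_sub sGG'.
- by move=> A B dA; apply/RI_or1/(G1MK_sub _ _ _ dA).
- by move=> A B dB; apply/RI_or2/(G1MK_sub _ _ _ dB).
- by move=> A B dB; apply/RI_imp/(G1MK_sub _ _ _ dB)/sub_mset1DS.
- by move=> S A sSG; apply: RI_box => x /sSG/sGG'.
- by move=> S A B /sGG' AG sSG; apply: (RI_dia _ _ _ _ AG) => x /sSG/sGG'.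
Qed.

(* In continuation-passing form, [C] is any goal provable from a derivation of
   [A] whose last rule is not a left rule. *)
Lemma G1MK_right_intro_ind (G G' : {mset form}) (A C : form) :
    G1MK G A -> {subset G <= G'} ->
    (forall G0, {subset G' <= G0} -> right_intro G0 A -> G1MK G0 C) ->
  G1MK G' C.
Proof.
(* The continuation accepts every extension of the antecedent, so it survives the side formulas that
   left rules add in their premisses. *)
have sub_cont A' X B : (forall G0, {subset X <= G0} -> right_intro G0 A' -> G1MK G0 C) ->
    forall G0, {subset B +` X <= G0} -> right_intro G0 A' -> G1MK G0 C.
  by move=> k G0 /sub_mset1D[_]; apply: k.
move=> dA; elim: dA G' => {G A}.
- by move=> A G' sAG; apply=> //; apply/RI_mem/sAG/mset11.
- move=> G A B D _ IH G' /sub_mset1D[ABG sGG'] k.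
  by apply: (G1MK_Land1_in _ _ _ ABG); apply: IH => //; [apply: sub_mset1DS|apply: sub_cont].
- move=> G A B D _ IH G' /sub_mset1D[ABG sGG'] k.
  by apply: (G1MK_Land2_in _ _ _ ABG); apply: IH => //; [apply: sub_mset1DS|apply: sub_cont].
- move=> G A B dA _ dB _ G' sGG'; apply=> //.
  by apply: RI_and; apply: G1MK_sub sGG'.
- move=> G A B D _ IHA _ IHB G' /sub_mset1D[ABG sGG'] k.
  by apply: (G1MK_Lor_in _ _ _ ABG); [apply: IHA|apply: IHB] => //;
    [apply: sub_mset1DS|apply: sub_cont|apply: sub_mset1DS|apply: sub_cont].
- by move=> G A B dA _ G' sGG'; apply=> //; apply/RI_or1/(G1MK_sub _ _ _ dA).
- by move=> G A B dB _ G' sGG'; apply=> //; apply/RI_or2/(G1MK_sub _ _ _ dB).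
- move=> G A B dB _ G' sGG'; apply=> //.
  by apply/RI_imp/(G1MK_sub _ _ _ dB)/sub_mset1DS.
- move=> G A B D dA _ _ IHB G' /sub_mset1D[ABG sGG'] k.
  apply: (G1MK_Limp_in _ _ _ ABG); first exact: G1MK_sub sGG'.
  by apply: IHB => //; [apply: sub_mset1DS|apply: sub_cont].
- by move=> G A D _ IH G' /sub_mset1D[_]; apply: IH.
- move=> G A D _ IH G' sAG; apply: IH => // x.
  by rewrite in_mset1D => /predU1P[->|/sAG//]; rewrite sAG ?mset1D1.
- by move=> S A dA _ G' sSG; apply=> //; apply: RI_box sSG dA.
- move=> S A B dB _ G' /sub_mset1D[AG sSG]; apply=> //.
  exact: RI_dia AG sSG dB.
Qed.

(** The context-sharing form of cut; the form with separate contexts follows by weakening both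
    premisses to the joint context. *)
Definition cut_admissible (A : form) : Prop :=
  forall (G : {mset form}) (C : form), G1MK G A -> G1MK (A +` G) C -> G1MK G C.

Definition subforms (A : form) : seq form :=
  match A with
  | Var _ | Bot => [::]
  | And B C | Or B C | Imp B C => [:: B; C]
  | Box B | Dia B => [:: B]
  end.

(** Prepares the modal rules, whose boxed antecedent may contain the cut formula. If [A] is [Box D],
    introduced from [S0 => D], then [D] is cut out of [S] and replaced by [S0]. In all other cases
    every box is already in [G], and [S] itself serves. [X] leaves room for the unboxed diamond of
    [K◇]. *)
Lemma cut_unbox (A : form) (S G : {mset form}) :
    (forall B, B \in subforms A -> cut_admissible B) ->
  right_intro G A -> {subset box_mset S <= A +` G} ->
  exists2 S', {subset box_mset S' <= G} &
    forall X E, G1MK (X `+` S) E -> G1MK (X `+` S') E.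
Proof.
move=> IHA rA /sub_box_mset sSG.
(* Members of [S] left out of [S1] have a box that can only be [A] itself. *)
pose S1 : {mset form} := seq_mset [seq B <- S | Box B \in G].
have sS1G: {subset box_mset S1 <= G}.
  by apply/sub_box_mset=> B; rewrite mem_seq_mset mem_filter => /andP[].
have inS1 B : B \in S -> Box B \in G -> B \in S1.
  by move=> BS BG; rewrite mem_seq_mset mem_filter BG.
have no_box: (forall B, B \in S -> Box B \in G) ->
    exists2 S', {subset box_mset S' <= G} &
    forall X E, G1MK (X `+` S) E -> G1MK (X `+` S') E.
  by move=> sS; exists S => //; apply/sub_box_mset.
case: rA IHA sSG.
- move=> D DG _ sSG; apply: no_box => B /sSG.
  by rewrite in_mset1D => /predU1P[->|].
- move=> D E _ _ _ sSG; apply: no_box => B /sSG.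
  by rewrite in_mset1D => /predU1P[].
1-3: by move=> D E _ _ sSG; apply: no_box => B /sSG; rewrite in_mset1D => /predU1P[].
- move=> S0 D sS0G dD IHD sSG; exists (S0 `+` S1).
    apply/sub_box_mset=> B /msetDP[]; first by move/sub_box_mset: sS0G; apply.
    by move/sub_box_mset: sS1G; apply.
  move=> X E dE; apply: (IHD D); first by rewrite mem_head.
    by apply: G1MK_sub dD _ => x xS0; rewrite !in_msetD xS0 orbT.
  apply: G1MK_sub dE _ => x /msetDP[xX|xS]; first by rewrite !in_msetD xX !orbT.
  have:= sSG _ xS; rewrite in_mset1D => /predU1P[[->]|/(inS1 _ xS) xS1].
    exact: mset1D1.
  by rewrite !in_msetD xS1 !orbT.
- move=> S0 D E _ _ _ _ sSG; apply: no_box => B /sSG.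
  by rewrite in_mset1D => /predU1P[].
Qed.

(** When a left rule acts on [A], [right_intro] leaves two possibilities: [A] is in [G], and the
    rule is applied to that occurrence, or the premisses of a right rule for [A] are at hand and
    cuts on subformulas suffice. *)
Lemma right_intro_cut (A C : form) (G' G : {mset form}) :
    (forall B, B \in subforms A -> cut_admissible B) ->
  G1MK G' C -> {subset G' <= A +` G} -> right_intro G A -> G1MK G C.
Proof.
move=> IHA.
have rD B X : right_intro X A -> right_intro (B +` X) A.
  by move=> rA; apply: right_intro_sub _ _ _ rA (@sub_mset1Dr _ _ _).
have memP P X : P \in A +` X -> P = A \/ P \in X.
  by rewrite in_mset1D => /predU1P.
move=> dC; elim: dC G => {G' C}.
- move=> C G sCG rA.
  have [->|] := memP _ _ (sCG C (mset11 _)); last exact: G1MK_mem.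
  (* Here [C] is [A], so its derivation is rebuilt from [right_intro G A]. *)
  case: rA => {IHA}.
  + by move=> ?; apply: G1MK_mem.
  + by move=> *; apply: G1MK_Rand.
  + by move=> *; apply: G1MK_Ror1.
  + by move=> *; apply: G1MK_Ror2.
  + by move=> *; apply: G1MK_Rimp.
  + by move=> S B sSG dB; apply: G1MK_sub (G1MK_KBox dB) sSG.
  + move=> S B D BG sSG dD; apply: G1MK_sub (G1MK_KDia dD) _ => x.
    by rewrite in_mset1D => /predU1P[->|/sSG].
- move=> G' B D C _ IH G /sub_mset1D[/memP BDG sG] rA.
  have {}IH := IH _ (sub_mset1DSA _ _ B _ _ sG) (rD B _ rA).
  (* Serves twice: when the principal formula is not the cut formula, and when it is but
     [right_intro] holds by membership. The other left rules follow this pattern. *)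
  have nonpr : And B D \in G -> G1MK G C by move=> H; apply: G1MK_Land1_in H IH.
  case: BDG => [EA|//]; move: rA IHA; rewrite -EA => rA IHA.
  inversion rA; subst; first exact: nonpr.
  by apply: (IHA B) IH => //; rewrite !inE eqxx.
- move=> G' B D C _ IH G /sub_mset1D[/memP BDG sG] rA.
  have {}IH := IH _ (sub_mset1DSA _ _ D _ _ sG) (rD D _ rA).
  have nonpr : And B D \in G -> G1MK G C by move=> H; apply: G1MK_Land2_in H IH.
  case: BDG => [EA|//]; move: rA IHA; rewrite -EA => rA IHA.
  inversion rA; subst; first exact: nonpr.
  by apply: (IHA D) IH => //; rewrite !inE eqxx orbT.
- by move=> G' B D _ IHB _ IHD G sG rA; apply: G1MK_Rand; [apply: IHB|apply: IHD].
- move=> G' B D C _ IHB _ IHD G /sub_mset1D[/memP BDG sG] rA.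
  have {}IHB := IHB _ (sub_mset1DSA _ _ B _ _ sG) (rD B _ rA).
  have {}IHD := IHD _ (sub_mset1DSA _ _ D _ _ sG) (rD D _ rA).
  have nonpr : Or B D \in G -> G1MK G C by move=> H; apply: G1MK_Lor_in H IHB IHD.
  case: BDG => [EA|//]; move: rA IHA; rewrite -EA => rA IHA.
  inversion rA; subst; first exact: nonpr.
    by apply: (IHA B) IHB => //; rewrite !inE eqxx.
  by apply: (IHA D) IHD => //; rewrite !inE eqxx orbT.
- by move=> G' B D _ IH G sG rA; apply/G1MK_Ror1/IH.
- by move=> G' B D _ IH G sG rA; apply/G1MK_Ror2/IH.
- move=> G' B D _ IH G sG rA; apply/G1MK_Rimp/IH; last exact: rD.
  exact: sub_mset1DSA.
- move=> G' B D C _ IHB _ IHD G /sub_mset1D[/memP BDG sG] rA.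
  have {}IHB := IHB _ sG rA.
  have {}IHD := IHD _ (sub_mset1DSA _ _ D _ _ sG) (rD D _ rA).
  have nonpr : Imp B D \in G -> G1MK G C by move=> H; apply: G1MK_Limp_in H IHB IHD.
  case: BDG => [EA|//]; move: rA IHA; rewrite -EA => rA IHA.
  inversion rA; subst; first exact: nonpr.
  (* A cut on the antecedent [B] first yields [D] from [G]; the cut on [D] then finishes. *)
  have dD : G1MK G D by apply: (IHA B) => //; rewrite !inE eqxx.
  by apply: (IHA D) IHD => //; rewrite !inE eqxx orbT.
- by move=> G' B C _ IH G /sub_mset1D[_ sG]; apply: IH.
- move=> G' B C _ IH G sG rA; apply: IH rA => x.
  (* Inclusion of sets ignores multiplicity, so duplicating a formula, even [A], preserves it. *)
  by rewrite in_mset1D => /predU1P[->|/sG//]; rewrite sG ?mset1D1.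
- move=> S B dB _ G sSG rA; have [S' sS'G cutS'] := cut_unbox _ _ _ IHA rA sSG.
  apply: G1MK_sub (G1MK_KBox _) sS'G.
  by rewrite -[S']mset0D; apply: cutS'; rewrite mset0D.
- move=> S B D dD _ G /sub_mset1D[/memP BG sSG] rA.
  have [S' sS'G cutS'] := cut_unbox _ _ _ IHA rA sSG.
  have {}dD := cutS' _ _ dD.
  have nonpr : Dia B \in G -> G1MK G (Dia D).
    move=> BG'; apply: G1MK_sub (G1MK_KDia dD) _ => x.
    by rewrite in_mset1D => /predU1P[->|/sS'G].
  case: BG => [EA|//]; move: rA IHA; rewrite -EA => rA IHA.
  inversion rA as [| | | | | |S0 E B' EG sS0G dB]; subst; first exact: nonpr.
  (* Both premisses end with [K◇]: cutting [E, S0 => B] against [B, S' => D] leaves one sequent, to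
     which [K◇] applies with principal formula [Dia E]. *)
  have dED : G1MK (E +` (S0 `+` S')) D.
    apply: (IHA B); first by rewrite !inE.
      by apply: G1MK_sub dB _ => x; rewrite !in_msetD orbA => ->.
    apply: G1MK_sub dD _ => x.
    by rewrite !in_msetD => /orP[]->; rewrite ?orbT.
  apply: G1MK_sub (G1MK_KDia dED) _ => x.
  rewrite in_mset1D => /predU1P[->//|]; move: x; apply/sub_box_mset=> F.
  move/sub_box_mset: sS0G => sS0G; move/sub_box_mset: sS'G => sS'G.
  by rewrite in_msetD => /orP[/sS0G|/sS'G].
Qed.

(** The left rules permuted below the cut may enlarge [G] to [G0]; the right premiss is reused
    unchanged, since [right_intro_cut] asks only for an inclusion. *)
Lemma cut_step (A : form) :
  (forall B, B \in subforms A -> cut_admissible B) -> cut_admissible A.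
Proof.
move=> IHA G C dA dC; apply: (G1MK_right_intro_ind _ _ _ _ dA) => // G0 sGG0.
by apply: right_intro_cut dC _ => //; apply: sub_mset1DS.
Qed.

Lemma cut_admissible_all (A : form) : cut_admissible A.
Proof.
elim: A => [p||A IHA B IHB|A IHA B IHB|A IHA B IHB|A IHA|A IHA];
  apply: cut_step => D; rewrite ?inE //.
1-3: by case/orP=> /eqP->.
1-2: by move/eqP->.
Qed.

Theorem mainTheorem7 (G S : {mset form}) (A C : form) :
  G1MK G A -> G1MK (A +` S) C -> G1MK (G `+` S) C.
Proof.
move=> dA dC; apply: (cut_admissible_all A).
  by apply: G1MK_sub dA _ => x xG; rewrite in_msetD xG.
apply: G1MK_sub dC _; apply: sub_mset1DS => x xS.
by rewrite in_msetD xS orbT.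
Qed.
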